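(* Let $G=(V,E)$ be a locally finite weighted graph satisfying the $CD\psi(n,-K)$ condition with $K\ge0$, where $\psi\in C^1(0,+\infty)$ is a concave function with $\psi'(1)>0$, $H_\psi<\infty$ and $\limsup_{\lambda\downarrow0}\frac{\eta_\psi(\lambda)}{\lambda^2}<\infty$. Then there exist constants $\rho,A>0$ depending only on $n,\psi$ and $D_\mu$ such that for any $x\in V$ and any $r\geq\frac12$, $$P_{t_r}\left(\mathbf 1_{B(x,r)}\right)(x)\geq\rho,$$ where $t_r=A\min\left\{r^2,\frac1K\right\}$, with the convention that $\frac1K=+\infty$ when $K=0$.
   Context: A locally finite weighted graph $G=(V,E)$ here means a connected graph in which every vertex has finitely many neighbours, with a vertex measure $\mu:V\to(0,\infty)$ and symmetric edge weights $w_{xy}=w_{yx}>0$ for $x\sim y$ (adjacent), such that $D_\mu:=\sup_{x}\frac{\deg(x)}{\mu(x)}<\infty$ where $\deg(x)=\sum_{y\sim x}w_{xy}$, $\mu_{\max}:=\sup_x\mu(x)<\infty$, and $w_{\min}:=\inf_{x\sim y}w_{xy}>0$. $d(x,y)$ is the combinatorial graph distance (minimal number of edges in a path) and $B(x,r)=\{y\in V: d(x,y)<r\}$. For $f:V\to\mathbb R$, $\Delta f(x)=\frac1{\mu(x)}\sum_{y\sim x}w_{xy}(f(y)-f(x))$. $\Delta$ is bounded on $\ell^\infty(V)$ (bounded functions, sup norm), and $P_t=e^{t\Delta}=\sum_{k\ge0}\frac{t^k}{k!}\Delta^k$, $t\ge0$. For $\psi\in C^1(0,\infty)$ and $f:V\to(0,\infty)$: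 $(\Delta^\psi f)(x)=\Delta\left[\psi\left(\frac{f}{f(x)}\right)\right](x)$. For concave $\psi$ put $\overline\psi(s)=\psi'(1)(s-1)-[\psi(s)-\psi(1)]$ and $\Gamma^\psi(f):=\Delta^{\overline\psi}f$, i.e. $\Gamma^\psi(f)(x)=\frac1{\mu(x)}\sum_{y\sim x}w_{xy}\overline\psi\left(\frac{f(y)}{f(x)}\right)$. Further $$\Omega^\psi f(x)=\Delta\left[\psi'\left(\frac f{f(x)}\right)\frac f{f(x)}\left(\frac{\Delta f}{f}-\frac{\Delta f(x)}{f(x)}\right)\right](x),$$ $$2\Gamma_2^\psi(f)=\Omega^\psi(f)+\frac{\Delta f\cdot\Delta^\psi f}{f}-\frac{\Delta(f\cdot\Delta^\psi f)}{f}.$$ For $n>0$ and $\kappa\in\mathbb R$, $G$ satisfies $CD\psi(n,\kappa)$ if for every $f:V\to(0,\infty)$, pointwise on $V$, $\Gamma_2^\psi(f)\ge\frac1n(\Delta^\psi f)^2+\kappa\,\Gamma^\psi(f)$. Constants of $\psi$: $H_\psi:=\sup_{s>1}\frac{(\log s)^2}{\overline\psi(s)}$ and, for $\lambda\ge0$, $\eta_\psi(\lambda):=\max\{\overline\psi(e^{\lambda}),\overline\psi(e^{-\lambda})\}$. *)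

(* Defs.v *)
From HB Require Import structures.
From mathcomp Require Import all_boot all_order all_algebra.
From mathcomp Require Import all_classical all_reals all_analysis.

Set Implicit Arguments.
Unset Strict Implicit.
Unset Printing Implicit Defensive.

Import Order.TTheory GRing.Theory Num.Theory.
Import numFieldNormedType.Exports.

Local Open Scope classical_set_scope.
Local Open Scope ring_scope.

(* The values of weight off the edges are irrelevant: they are never used. *)
Record wgraph (R : realType) (V : choiceType) := WGraph {
  adj : rel V;
  weight : V -> V -> R;
  vmeas : V -> R;
  adj_irr : irreflexive adj;
  adj_sym : symmetric adj;
  adj_fin : forall x, finite_set [set y | adj x y];
  adj_conn : forall x y, exists p, path adj x p && (last x p == y);
  weight_gt0 : forall x y, adj x y -> 0 < weight x y;
  weight_sym : forall x y, adj x y -> weight x y = weight y x;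
  vmeas_gt0 : forall x, 0 < vmeas x }.

Section Graph.
Context {R : realType} {V : choiceType} (G : wgraph R V).
Implicit Types (f : V -> R) (x y : V).

Definition nbrs x : set V := [set y | adj G x y].

Definition deg x : R := \sum_(y \in nbrs x) weight G x y.

Definition Dmu : \bar R := ereal_sup (range (fun x => (deg x / vmeas G x)%:E)).

Definition mu_max : \bar R := ereal_sup (range (fun x => (vmeas G x)%:E)).

Definition w_min : \bar R :=
  ereal_inf [set (weight G e.1 e.2)%:E | e in [set e : V * V | adj G e.1 e.2]].

Definition walk_len x y : pred nat :=
  fun n => `[< exists p, [/\ path (adj G) x p, last x p = y & size p = n] >].

Lemma walk_len_ex x y : exists n, walk_len x y n.
Proof.
have [p /andP[xp /eqP py]] := adj_conn G x y.
by exists (size p); apply/asboolP; exists p.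
Qed.

Definition gdist x y : nat := ex_minn (walk_len_ex x y).

Definition gball x (r : R) : set V := [set y | (gdist x y)%:R < r].

Definition lap f : V -> R :=
  fun x => (vmeas G x)^-1 * \sum_(y \in nbrs x) weight G x y * (f y - f x).

(* For bounded f and Dmu < +oo, the norm-convergent series in l^oo(V) that
   defines e^(t lap) f converges pointwise to the same function; its value at x
   is the sum of the real series below. *)
Definition heat (t : R) f : V -> R :=
  fun x => limn (series (fun k => t ^+ k / k`!%:R * iter k lap f x)).

Definition lap_psi (psi : R -> R) f : V -> R :=
  fun x => lap (fun y => psi (f y / f x)) x.

Definition psi_bar (psi : R -> R) : R -> R :=
  fun s => derive1 psi 1 * (s - 1) - (psi s - psi 1).

Definition Gamma_psi (psi : R -> R) f : V -> R := lap_psi (psi_bar psi) f.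

Definition Omega_psi (psi : R -> R) f : V -> R :=
  fun x => lap (fun y =>
    derive1 psi (f y / f x) * (f y / f x) * (lap f y / f y - lap f x / f x)) x.

Definition Gamma2_psi (psi : R -> R) f : V -> R :=
  fun x => 2^-1 * (Omega_psi psi f x + lap f x * lap_psi psi f x / f x
                   - lap (fun y => f y * lap_psi psi f y) x / f x).

Definition CDpsi (psi : R -> R) (n kappa : R) : Prop :=
  forall f, (forall x, 0 < f x) -> forall x,
    Gamma2_psi psi f x >= n^-1 * lap_psi psi f x ^+ 2 + kappa * Gamma_psi psi f x.

End Graph.

Section Psi.
Context {R : realType}.
Implicit Type psi : R -> R.

(* psi is a total function, but only its values on (0, +oo) matter. *)
Definition C1_pos psi : Prop :=
  (forall s : R, 0 < s -> derivable psi s 1) /\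
  (forall s : R, 0 < s -> {for s, continuous (derive1 psi)}).

Definition concave_pos psi : Prop :=
  @convex_function R R^o `]0, +oo[ (fun s => - psi s).

(* The quotient is taken in \bar R, where 0^-1 = +oo: the supremum is +oo as
   soon as psi_bar vanishes at some s > 1. *)
Definition H_psi psi : \bar R :=
  ereal_sup [set ((ln s ^+ 2)%:E / (psi_bar psi s)%:E)%E | s in `]1, +oo[].

Definition eta_psi psi (l : R) : R :=
  Num.max (psi_bar psi (expR l)) (psi_bar psi (expR (- l))).

Definition limsup_eta psi : \bar R :=
  limf_esup (fun l : R => (eta_psi psi l / l ^+ 2)%:E) 0^'+.

End Psi.

Definition time_scale {R : realType} (A r K : R) : R :=
  A * (if K == 0 then r ^+ 2 else Num.min (r ^+ 2) K^-1).

(* Main.v *)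
(* Fix f = exp(l * min(d(x, .), m)) with l of order 1/r, and let p = psi'(1).
   Along the semigroup, the quantity Phi(s) = P_s(u Gamma^psi(u))(x) with
   u = P_{T-s} f has derivative 2 P_s(u Gamma_2^psi(u))(x), and
   Phi(s) + P_s(u Delta^psi u)(x) = p Delta P_T f(x) =: Y does not depend on s.
   The bound on eta_psi gives Phi(T) <= E P_T f(x) with E of order l^2, and
   CDpsi(n, -K) gives Phi' >= (2/n) P_s(u (Delta^psi u)^2)(x) - 2 K Phi.  So if
   Y >= 4 C E P_T f(x), where C = exp(2 K T), then P_s(u Delta^psi u)(x) >= Y/2
   for all s, and Jensen's inequality yields Y^2 T <= 4 n C E (P_T f(x))^2.
   Hence (log P_T f(x))' <= C' (l^2 + l / sqrt T), which is integrable at T = 0: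
   log P_T f(x) <= C'' (l^2 T + l sqrt T), arbitrarily small compared with l r
   for T <= A r^2 with A small.  Markov's inequality concludes.

   The semigroup is replaced by the iterates of the Euler operator
   Q = 1 + h Delta, with t = N h; these are positive, fix constants and converge
   to P_t on bounded functions. *)
Require Import Defs.
From mathcomp Require Import finmap.
From HB Require Import structures.
From mathcomp Require Import all_boot all_order all_algebra.
From mathcomp Require Import all_classical all_reals all_analysis.
From mathcomp Require Import zify ring lra.
Import Order.TTheory GRing.Theory Num.Theory.
Import numFieldNormedType.Exports.
Local Open Scope classical_set_scope.
Local Open Scope ring_scope.

(** * Concave C^1 functions on the half-line, and Euler's limit for the exponential *)

Section PsiCalculus.
Context {R : realType}.
Implicit Types (psi : R -> R) (a b c : R).

Lemma concave_posE {psi} : concave_pos psi -> forall a b t, 0 < a -> 0 < b ->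
  0 <= t <= 1 -> t * psi a + (1 - t) * psi b <= psi (t * a + (1 - t) * b).
Proof.
move=> cvx a b t a0 b0 /andP[t0 t1].
have t01 : (0 <= t) && (t <= 1) by rewrite t0 t1.
pose T : {i01 R} := Itv01 t0 t1.
have := cvx T a b; rewrite !inE /= !in_itv /= !andbT => /(_ a0 b0).
rewrite /conv /= /unstable.onem /= => H.
rewrite -lerN2 opprD -!mulrN; exact: H.
Qed.

(** Concavity bounds the increment from [a] to [b] by any difference quotient at [a] in the
    direction of [b], multiplied by [b - a]. A gap [d] above the tangent would keep these quotients
    away from their limit, the derivative. *)
Lemma concave_pos_tangent {psi} a b : C1_pos psi -> concave_pos psi ->
  0 < a -> 0 < b -> psi b <= psi a + derive1 psi a * (b - a).
Proof.
move=> [drv _] cvx a0 b0; rewrite leNgt; apply/negP => lt_b.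
have ba0 : 0 < `|b - a|.
  rewrite normr_gt0 subr_eq0; apply/eqP => ba.
  by move: lt_b; rewrite ba subrr mulr0 addr0 ltxx.
pose d := psi b - (psi a + derive1 psi a * (b - a)).
have d0 : 0 < d by rewrite subr_gt0.
have /cvgrPdist_lt /(_ (d / `|b - a|)) := drv a a0.
rewrite divr_gt0// => /(_ isT) [e /= e0 He].
pose t := Num.min (2^-1) (e / (2 * `|b - a|)).
have t0 : 0 < t by rewrite lt_min invr_gt0 ltr0n divr_gt0// mulr_gt0.
have t1 : t <= 1 by rewrite ge_min invf_le1 ?ler1n.
have te : t * `|b - a| < e.
  have : t <= e / (2 * `|b - a|) by rewrite ge_min lexx orbT.
  rewrite ler_pdivlMr ?mulr_gt0// => H.
  by rewrite (@le_lt_trans _ _ (e / 2)) ?ltr_pdivrMr//; lra.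
have h0 : t * (b - a) != 0 by rewrite mulf_neq0 // ?(gt_eqF t0) // -normr_gt0.
have := He (t * (b - a)); rewrite /= sub0r normrN normrM (gtr0_norm t0).
move=> /(_ te h0); rewrite -[lim _]/('D_1 psi a) -derive1E.
rewrite /GRing.scale /= mulr1 => bound.
have t01 : 0 <= t <= 1 by rewrite (ltW t0) t1.
have := concave_posE cvx b a t b0 a0 t01.
rewrite (_ : t * b + (1 - t) * a = t * (b - a) + a); last by ring.
move=> slope; set q := (t * (b - a))^-1 * _ in bound.
have qE : q * (b - a) * t = psi (t * (b - a) + a) - psi a.
  have ba : b - a != 0 by rewrite -normr_gt0.
  by rewrite /q mulrC; field; rewrite ba gt_eqF.
have step : psi b - psi a <= q * (b - a).
  by rewrite -(ler_pM2r t0) qE; lra.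
move: bound; rewrite ltr_pdivlMr// -normrM => bound.
have := ler_norm ((q - derive1 psi a) * (b - a)).
rewrite -normrN -mulNr opprB => le1.
by have := le_lt_trans le1 bound; rewrite /d; lra.
Qed.

(** Heine's theorem, through the near-covering form of compactness: around each [c] a single radius
    serves all nearby centres. *)
Lemma derive1_unif_cont psi m M : C1_pos psi -> 0 < m ->
  forall e, 0 < e -> exists2 d, 0 < d & forall c c', m <= c <= M -> m <= c' <= M ->
    `|c - c'| < d -> `|derive1 psi c - derive1 psi c'| <= e.
Proof.
move=> [_ cont] m0 e e0.
have /compact_near_coveringP cov := @segment_compact R m M.
pose P (d : R) c := forall c', `|c - c'| < d -> `|derive1 psi c - derive1 psi c'| <= e.
have [] := cov R (0^'+) P _ _.
- move=> c; rewrite /= in_itv /= => /andP[mc _].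
  have c0 : 0 < c := lt_le_trans m0 mc.
  have /cvgrPdist_lt /(_ (e / 2)) := cont c c0.
  rewrite divr_gt0// => /(_ isT) [r /= r0 Hr].
  exists (ball c (r / 2), [set d | d < r / 2]).
    split => /=; first by exists (r / 2); rewrite //= divr_gt0.
    by exists (r / 2) => /=; rewrite ?divr_gt0// => y /=; rewrite sub0r normrN => /ltr_normlW.
  move=> [c1 d] /= [cc1 dr] c' c1c'.
  have h1 := Hr c1; have h2 := Hr c'.
  rewrite /ball /= in h1 h2 cc1.
  have l1 : `|c - c1| < r by rewrite (lt_trans cc1)// ltr_pdivrMr//; lra.
  have l2 : `|c - c'| < r.
    rewrite -(subrKA c1) (le_lt_trans (ler_normD _ _))//.
    by rewrite [ltRHS]splitr ltrD// (lt_trans c1c').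
  have {}h1 := h1 l1; have {}h2 := h2 l2.
  rewrite -(subrKA (derive1 psi c)) (le_trans (ler_normD _ _))//.
  by rewrite (distrC _ (derive1 psi c)) [leRHS]splitr lerD// ltW.
- move=> d /= d0 Hd; exists (d / 2); first by rewrite divr_gt0.
  move=> c c' mc mc' cc'.
  apply: (Hd (d / 2)) => //=; rewrite ?divr_gt0 ?in_itv//.
  by rewrite sub0r normrN gtr0_norm ?divr_gt0// ltr_pdivrMr//; lra.
Qed.

Lemma C1_pos_bounded psi m M : C1_pos psi -> 0 < m -> m <= M ->
  exists B, forall c, m <= c <= M -> `|psi c - psi 1| <= B.
Proof.
move=> [drv _] m0 mM.
have [] := @EVT_max R (fun c => `|psi c - psi 1|) m M mM.
  apply: continuous_in_subspaceT => /= c; rewrite inE /= in_itv /= => /andP[mc _].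
  have /derivable1_diffP /differentiable_continuous cpsi := drv c (lt_le_trans m0 mc).
  exact: (cvg_norm (cvgB cpsi (cvg_cst _))).
by move=> c _ Hc; exists `|psi c - psi 1| => c' mc'; apply: Hc; rewrite in_itv.
Qed.

Lemma psi_bar1 psi : psi_bar psi 1 = 0.
Proof. by rewrite /psi_bar !subrr mulr0 subr0. Qed.

Lemma psi_bar_ge0 psi c : C1_pos psi -> concave_pos psi -> 0 < c ->
  0 <= psi_bar psi c.
Proof.
move=> C1 cvx c0; have := concave_pos_tangent 1 c C1 cvx ltr01 c0.
by rewrite /psi_bar; lra.
Qed.

Lemma eta_psi_quadratic psi : (limsup_eta psi < +oo)%E ->
  exists C l0 : R, [/\ 0 < C, 0 < l0 &
    forall l, 0 < l < l0 -> eta_psi psi l <= C * l ^+ 2].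
Proof.
move=> /ereal_inf_lt [_ [S [d /= d0 HS] <-] supS].
(* Finiteness of the limsup only puts this supremum below +oo; it has a real upper bound even if its
   value is -oo. *)
have [s supSs] : exists s : R, (ereal_sup [set (eta_psi psi l / l ^+ 2)%:E | l in S] <= s%:E)%E.
  by case: (ereal_sup _) supS => [s _|//|_]; [exists s|exists 0; rewrite leNye].
exists (`|s| + 1), d; split => //.
move=> l /andP[l0 ld].
have Sl : S l by apply: HS => //=; rewrite sub0r normrN gtr0_norm.
have : ((eta_psi psi l / l ^+ 2)%:E <= s%:E)%E.
  by apply: le_trans supSs; apply: ereal_sup_ubound; exists l.
rewrite lee_fin ler_pdivrMr ?exprn_gt0// => H.
by apply: (le_trans H); rewrite ler_wpM2r ?sqr_ge0//; have := ler_norm s; lra.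
Qed.

(** With y = x / (n + 1), a squeeze between the powers of exp(y - y^2) and exp(y). The lower bound
    exp(y - y^2) <= 1 + y holds because (1 + y)(1 - y + y^2) = 1 + y^3 >= 1. *)
Lemma exprn_1Ddiv_cvg (x : R) : 0 <= x ->
  (1 + x / n.+1%:R) ^+ n.+1 @[n --> \oo] --> expR x.
Proof.
move=> x0.
have hy n : 0 <= x / n.+1%:R :> R by rewrite divr_ge0.
have lb n : expR (x - x ^+ 2 / n.+1%:R) <= (1 + x / n.+1%:R) ^+ n.+1.
  set y := x / n.+1%:R; have y0 : 0 <= y := hy n.
  have n0 : n.+1%:R != 0 :> R by rewrite pnatr_eq0.
  have h1 : expR (y - y ^+ 2) <= 1 + y.
    have := expR_ge1Dx (- (y - y ^+ 2)); rewrite expRN => h.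
    have h2 : 0 < 1 - (y - y ^+ 2) by nra.
    have : expR (y - y ^+ 2) <= (1 - (y - y ^+ 2))^-1.
      by rewrite -[leLHS]invrK lef_pV2// posrE invr_gt0 expR_gt0.
    move/le_trans; apply; rewrite -div1r ler_pdivrMr//.
    have : 0 <= y ^+ 3 by rewrite exprn_ge0.
    by rewrite !exprS expr0; nra.
  have -> : x - x ^+ 2 / n.+1%:R = n.+1%:R * (y - y ^+ 2).
    by rewrite /y; field.
  by rewrite mulrC expRM_natr lerXn2r// ?nnegrE ?expR_ge0// addr_ge0.
have ub n : (1 + x / n.+1%:R) ^+ n.+1 <= expR x.
  have n0 : n.+1%:R != 0 :> R by rewrite pnatr_eq0.
  have {2}-> : x = x / n.+1%:R * n.+1%:R by field.
  by rewrite expRM_natr lerXn2r ?nnegrE ?expR_ge0 ?addr_ge0 ?expR_ge1Dx.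
apply: (@squeeze_cvgr _ _ _ _ (fun n => expR (x - x ^+ 2 / n.+1%:R)) (fun=> expR x)).
- by apply: nearW => n; rewrite lb ub.
- have lim : (x - x ^+ 2 / n.+1%:R) @[n --> \oo] --> x.
    have := cvgB (cvg_cst x) (cvgM (cvg_cst (x ^+ 2)) (@cvg_harmonic R)).
    by rewrite mulr0 subr0; exact.
  exact: (cvg_comp _ _ lim (@continuous_expR R x)).
- exact: cvg_cst.
Qed.

End PsiCalculus.

(** * Algebra of the Euler operator 1 + h Delta *)

Section Euler.
Context {R : realType} {V : choiceType} (G : wgraph R V).
Implicit Types (f g F : V -> R) (x y : V) (h c : R) (N : nat).

(** Not normalised: the total mass is [deg G x / vmeas G x]. The function [F] may itself depend on
    [x], so that [lap], [lap_psi] and [Gamma_psi] at [x] are all of this form. *)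
Definition nbr_avg x F : R := (vmeas G x)^-1 * \sum_(y \in nbrs G x) weight G x y * F y.

Definition euler h f : V -> R := fun x => f x + h * lap G f x.

Lemma nbr_avgE x F : nbr_avg x F =
  (vmeas G x)^-1 * \sum_(y <- fset_set (nbrs G x)) weight G x y * F y.
Proof. by rewrite /nbr_avg fsbig_finite//; exact: adj_fin. Qed.

Lemma lapE f x : lap G f x = nbr_avg x (fun y => f y - f x).
Proof. by []. Qed.

Lemma nbr_avg_linear x c F1 F2 :
  nbr_avg x (fun y => c * F1 y + F2 y) = c * nbr_avg x F1 + nbr_avg x F2.
Proof.
rewrite !nbr_avgE mulrCA -mulrDr [c * _]mulr_sumr -big_split/=.
by congr (_ * _); apply: eq_bigr => y _; ring.
Qed.

Lemma ler_nbr_avg x F1 F2 : (forall y, adj G x y -> F1 y <= F2 y) ->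
  nbr_avg x F1 <= nbr_avg x F2.
Proof.
move=> F12; rewrite !nbr_avgE ler_pM2l ?invr_gt0 ?vmeas_gt0// big_seq [leRHS]big_seq.
apply: ler_sum => y; rewrite in_fset_set; last exact: adj_fin.
by move=> /set_mem xy; apply: ler_wpM2l; [exact/ltW/weight_gt0|exact: F12].
Qed.

Lemma eq_nbr_avg x F1 F2 : (forall y, adj G x y -> F1 y = F2 y) ->
  nbr_avg x F1 = nbr_avg x F2.
Proof. by move=> F12; apply/eqP; rewrite eq_le !ler_nbr_avg// => y /F12 ->. Qed.

Lemma nbr_avgZ x c F : nbr_avg x (fun y => c * F y) = c * nbr_avg x F.
Proof. by rewrite !nbr_avgE mulrCA [c * _]mulr_sumr; congr (_ * _); apply: eq_bigr => y _; ring. Qed.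

Lemma nbr_avgD x F1 F2 : nbr_avg x (fun y => F1 y + F2 y) = nbr_avg x F1 + nbr_avg x F2.
Proof. by rewrite -[nbr_avg x F1]mul1r -nbr_avg_linear; apply: eq_nbr_avg => y _; rewrite mul1r. Qed.

Lemma nbr_avg_cst x c : nbr_avg x (fun=> c) = c * (deg G x / vmeas G x).
Proof.
rewrite /nbr_avg /deg !fsbig_finite; [|exact: adj_fin..].
by rewrite -mulr_suml; ring.
Qed.

Lemma lap_linear c f g x :
  lap G (fun y => c * f y + g y) x = c * lap G f x + lap G g x.
Proof. by rewrite !lapE -nbr_avg_linear; apply: eq_nbr_avg => y _; ring. Qed.

Lemma euler_linear h c f g x :
  euler h (fun y => c * f y + g y) x = c * euler h f x + euler h g x.
Proof. by rewrite /euler lap_linear; ring. Qed.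

(** The form that shows positivity: for [h] nonnegative and small, both coefficients are
    nonnegative. *)
Lemma eulerE h f x :
  euler h f x = (1 - h * (deg G x / vmeas G x)) * f x + h * nbr_avg x f.
Proof.
rewrite /euler lapE.
have -> : nbr_avg x (fun y => f y - f x) = nbr_avg x f - f x * (deg G x / vmeas G x).
  rewrite -nbr_avg_cst -[- nbr_avg _ _]mulN1r [RHS]addrC -nbr_avg_linear.
  by apply: eq_nbr_avg => y _; ring.
by ring.
Qed.

Lemma euler_cst h c x : euler h (fun=> c) x = c.
Proof. by rewrite eulerE nbr_avg_cst; ring. Qed.

Lemma lap_euler h f : lap G (euler h f) = euler h (lap G f).
Proof.
apply/funext => x; rewrite {2}/euler addrC -lap_linear.
by apply: eq_nbr_avg => y _; rewrite /euler; ring.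
Qed.

Lemma lap_iter_euler N h f :
  lap G (iter N (euler h) f) = iter N (euler h) (lap G f).
Proof. by elim: N => //= N <-; rewrite lap_euler. Qed.

Lemma iter_euler_linear N h c f g x :
  iter N (euler h) (fun y => c * f y + g y) x =
  c * iter N (euler h) f x + iter N (euler h) g x.
Proof.
elim: N x => //= N IH x; rewrite -euler_linear; congr (euler h _ x).
exact/funext.
Qed.

Lemma iter_eulerZ N h c f x :
  iter N (euler h) (fun y => c * f y) x = c * iter N (euler h) f x.
Proof.
elim: N x => //= N IH x.
have -> : iter N (euler h) (fun y => c * f y) = (fun y => c * iter N (euler h) f y + 0).
  by apply/funext => y; rewrite addr0.
by rewrite euler_linear euler_cst addr0.
Qed.

Lemma iter_eulerD N h f g x :
  iter N (euler h) (fun y => f y + g y) x =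
  iter N (euler h) f x + iter N (euler h) g x.
Proof.
rewrite -[iter N _ f x]mul1r -iter_euler_linear; congr (iter N _ _ x).
by apply/funext => y; rewrite mul1r.
Qed.

Lemma iter_euler_cst N h c x : iter N (euler h) (fun=> c) x = c.
Proof.
elim: N x => //= N IH x; rewrite -[RHS](euler_cst h c x); congr (euler h _ x).
exact/funext.
Qed.

(** The binomial theorem for (1 + h Delta)^N, by Pascal's rule; it allows a termwise comparison with
    the exponential series. *)
Lemma iter_euler_binomial N h f x :
  iter N (euler h) f x = \sum_(k < N.+1) 'C(N, k)%:R * h ^+ k * iter k (lap G) f x.
Proof.
elim: N f => [|N IH] f; first by rewrite big_ord_recl big_ord0 /= bin0 expr0; ring.
rewrite iterSr.
have -> : iter N (euler h) (euler h f) x =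
    iter N (euler h) f x + h * iter N (euler h) (lap G f) x.
  by rewrite addrC -iter_euler_linear; congr (iter N _ _ x); apply/funext => y; rewrite /euler addrC.
rewrite !IH big_ord_recl [in RHS]big_ord_recl /= !bin0 !expr0 mul1r -!addrA; congr (_ + _).
rewrite [in RHS]big_ord_recr/= [in LHS](big_ord_recr _ (fun k => 'C(N, k)%:R * h ^+ k * _))/=.
rewrite mulrDr mulr_sumr addrA -big_split/=; congr (_ + _).
  apply: eq_bigr => k _; rewrite /bump leq0n add1n binS natrD exprS -iterSr /= add0n; ring.
by rewrite /bump leq0n add1n add0n !binn exprS -iterSr /=; ring.
Qed.

End Euler.

(** * Positivity of the Euler operator, and convergence of its iterates to the semigroup on bounded
    functions *)

Lemma ffact_leq_expn n k : (n ^_ k <= n ^ k)%N.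
Proof. by elim: k => // k IH; rewrite ffactnSr expnSr leq_mul// leq_subr. Qed.

Section BoundedEuler.
Context {R : realType} {V : choiceType} (G : wgraph R V) (D : R).
Context (degD : forall x, deg G x / vmeas G x <= D).
Implicit Types (f g F : V -> R) (x y : V) (h c M B : R) (N : nat).

Lemma deg_ratio_ge0 x : 0 <= deg G x / vmeas G x.
Proof.
have := @ler_nbr_avg _ _ G x (fun=> 0) (fun=> 1) (fun _ _ => ler01).
by rewrite !nbr_avg_cst mul0r mul1r.
Qed.

Lemma norm_nbr_avg x F B : (forall y, adj G x y -> `|F y| <= B) -> 0 <= B ->
  `|nbr_avg G x F| <= D * B.
Proof.
move=> FB B0; rewrite ler_norml.
have le1 : nbr_avg G x F <= D * B.
  apply: (@le_trans _ _ (nbr_avg G x (fun=> B))).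
    by apply: ler_nbr_avg => y /FB; rewrite ler_norml => /andP[].
  by rewrite nbr_avg_cst mulrC ler_wpM2r.
rewrite le1 andbT; apply: (@le_trans _ _ (nbr_avg G x (fun=> - B))).
  by rewrite nbr_avg_cst mulNr lerN2 mulrC ler_wpM2r.
by apply: ler_nbr_avg => y /FB; rewrite ler_norml => /andP[].
Qed.

Lemma norm_lap f M x : (forall y, `|f y| <= M) -> `|lap G f x| <= 2 * D * M.
Proof.
move=> fM; have M0 : 0 <= M := le_trans (normr_ge0 _) (fM x).
rewrite lapE (le_trans (@norm_nbr_avg _ _ (2 * M) _ _))//; last by lra.
- by move=> y _; have := fM x; have := fM y; have := ler_normB (f y) (f x); lra.
- by rewrite mulr_ge0.
Qed.

Lemma norm_iter_lap f M k x : (forall y, `|f y| <= M) ->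
  `|iter k (lap G) f x| <= (2 * D) ^+ k * M.
Proof.
move=> fM; elim: k x => [|k IH] x; first by rewrite expr0 mul1r.
by rewrite exprS -mulrA; exact: norm_lap.
Qed.

Section Contraction.
Context (h : R).
Context (h0 : 0 <= h) (hD : h * D <= 1).

Lemma euler_ge0 f : (forall y, 0 <= f y) -> forall x, 0 <= euler G h f x.
Proof.
move=> f0 x; rewrite eulerE addr_ge0//; last first.
  rewrite mulr_ge0//; have := @ler_nbr_avg _ _ G x (fun=> 0) f (fun y _ => f0 y).
  by rewrite nbr_avg_cst mul0r.
rewrite mulr_ge0// subr_ge0; apply: le_trans hD.
exact: ler_wpM2l.
Qed.

Lemma iter_euler_ge0 N f : (forall y, 0 <= f y) -> forall x, 0 <= iter N (euler G h) f x.
Proof. by move=> f0; elim: N => //= N IH; exact: euler_ge0. Qed.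

Lemma ler_iter_euler N f g : (forall y, f y <= g y) ->
  forall x, iter N (euler G h) f x <= iter N (euler G h) g x.
Proof.
move=> fg x; rewrite -subr_ge0.
have := @iter_euler_ge0 N (fun y => -1 * f y + g y) _ x.
rewrite iter_euler_linear mulN1r addrC; apply=> y.
by rewrite mulN1r addrC subr_ge0.
Qed.

Lemma iter_euler_bounds N f a b : (forall y, a <= f y <= b) ->
  forall x, a <= iter N (euler G h) f x <= b.
Proof.
move=> fab x; apply/andP; split.
  rewrite -[leLHS](iter_euler_cst G N h a x); apply: ler_iter_euler => y.
  by have /andP[] := fab y.
rewrite -[leRHS](iter_euler_cst G N h b x); apply: ler_iter_euler => y.
by have /andP[] := fab y.
Qed.

End Contraction.

(** The Euler coefficient C(n+1, k) / (n+1)^k is at most 1 / k!, and Delta^k f is bounded by (2 D)^k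
    M. Hence the distance to the partial sum of the series is at most [M] times the same difference
    for the scalar [X = 2 * D * t], which tends to 0. *)
Lemma heat_euler_cvg t f M x : 0 <= t -> (forall y, `|f y| <= M) ->
  iter n.+1 (euler G (t / n.+1%:R)) f x @[n --> \oo] --> heat G t f x.
Proof.
move=> t0 fM; have M0 : 0 <= M := le_trans (normr_ge0 _) (fM x).
have D0 : 0 <= D := le_trans (deg_ratio_ge0 x) (degD x).
pose X := 2 * D * t; have X0 : 0 <= X by rewrite !mulr_ge0.
pose L k := iter k (lap G) f x.
have LM k : `|L k| <= (2 * D) ^+ k * M by exact: norm_iter_lap.
pose a k := t ^+ k / k`!%:R * L k.
have aX k : `|a k| <= M * exp_coeff X k.
  rewrite normrM ger0_norm ?divr_ge0 ?exprn_ge0//.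
  rewrite (le_trans (ler_wpM2l _ (LM k))) ?divr_ge0 ?exprn_ge0//.
  by rewrite exp_coeffE /X /= !exprMn; rewrite le_eqVlt; apply/orP; left; apply/eqP; ring.
have cva : cvgn (series a).
  apply: normed_cvg; apply: (@series_le_cvg _ _ (fun k => M * exp_coeff X k)) => //.
  - by move=> k; exact: normr_ge0.
  - by move=> k; rewrite mulr_ge0// exp_coeff_ge0.
  - by apply: (@is_cvg_seriesZ _ (exp_coeff X) M); exact: is_cvg_series_exp_coeff.
(* The Euler polynomial has degree [n.+1], hence [n.+2] terms to be matched. *)
have cvs : series a n.+2 @[n --> \oo] --> heat G t f x.
  by have := cva; rewrite -(cvg_shiftn 2) /=; under eq_cvg do rewrite addn2.
have cve : M * (series (exp_coeff X) n.+2 - (1 + X / n.+1%:R) ^+ n.+1) @[n --> \oo] --> (0 : R).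
  have cvE : series (exp_coeff X) n.+2 @[n --> \oo] --> expR X.
    have : series (exp_coeff X) @ \oo --> expR X := is_cvg_series_exp_coeff X.
    by rewrite -(cvg_shiftn 2) /=; under eq_cvg do rewrite addn2.
  have := cvgM (cvg_cst M) (cvgB cvE (exprn_1Ddiv_cvg X X0)).
  by rewrite subrr mulr0; exact.
have diff n : `|iter n.+1 (euler G (t / n.+1%:R)) f x - series a n.+2| <=
    M * (series (exp_coeff X) n.+2 - (1 + X / n.+1%:R) ^+ n.+1).
  have sE u m : series u m = \sum_(k < m) u k :> R by rewrite /series /= big_mkord.
  rewrite iter_euler_binomial !sE -sumrB.
  rewrite (le_trans (ler_norm_sum _ _ _))//.
  rewrite exprDn -sumrB mulr_sumr; apply: ler_sum => k _.
  have -> : 'C(n.+1, k)%:R * (t / n.+1%:R) ^+ k * iter k (lap G) f x - a k =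
      - ((1 / k`!%:R - 'C(n.+1, k)%:R / n.+1%:R ^+ k) * t ^+ k * L k).
    by rewrite /a /L expr_div_n; ring.
  have c0 : 0 <= 1 / k`!%:R - 'C(n.+1, k)%:R / n.+1%:R ^+ k :> R.
    rewrite subr_ge0 ler_pdivrMr ?exprn_gt0// mulrAC ler_pdivlMr ?ltr0n ?fact_gt0// mul1r.
    by rewrite -natrM bin_ffact -natrX ler_nat ffact_leq_expn.
  rewrite normrN normrM ger0_norm ?mulr_ge0 ?exprn_ge0//.
  rewrite (le_trans (ler_wpM2l _ (LM k))) ?mulr_ge0 ?exprn_ge0//.
  rewrite exp_coeffE /X /= expr1n mul1r expr_div_n !exprMn -mulr_natr.
  by rewrite le_eqVlt; apply/orP; left; apply/eqP; ring.
have cvd : (iter n.+1 (euler G (t / n.+1%:R)) f x - series a n.+2) @[n --> \oo] --> (0 : R).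
  apply: norm_cvg0; apply: (@squeeze_cvgr _ _ _ _ (fun=> 0)
    (fun n => M * (series (exp_coeff X) n.+2 - (1 + X / n.+1%:R) ^+ n.+1))) => //.
    by apply: nearW => n; rewrite normr_ge0 diff.
  exact: cvg_cst.
rewrite -[heat G t f x]addr0.
have -> : (fun n => iter n.+1 (euler G (t / n.+1%:R)) f x) =
    (fun n => series a n.+2) \+ (fun n => iter n.+1 (euler G (t / n.+1%:R)) f x - series a n.+2).
  by apply/funext => n /=; rewrite addrC subrK.
exact: cvgD cvs cvd.
Qed.

End BoundedEuler.

(** * One Euler step for u Delta^psi u and u Gamma^psi(u) *)

Section GammaStep.
Context {R : realType} {V : choiceType} (G : wgraph R V) (D : R).
Context (psi : R -> R).
Context (D_ge0 : 0 <= D) (degD : forall x, deg G x / vmeas G x <= D).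
Context (psi_C1 : C1_pos psi) (psi_concave : concave_pos psi).
Implicit Types (u f : V -> R) (x y : V) (a b h M : R).

Lemma lap_psiE u x : 0 < u x ->
  lap_psi G psi u x = nbr_avg G x (fun y => psi (u y / u x) - psi 1).
Proof. by move=> ux; rewrite /lap_psi lapE divff ?gt_eqF. Qed.

(** The source of the conserved quantity: the two psi-terms add up to a multiple of [lap G u x], and
    the Laplacian commutes with Euler steps. *)
Lemma Gamma_psiE u x : (forall y, 0 < u y) ->
  u x * Gamma_psi G psi u x = derive1 psi 1 * lap G u x - u x * lap_psi G psi u x.
Proof.
move=> u0; rewrite lap_psiE// /Gamma_psi /lap_psi !lapE divff ?gt_eqF// -nbr_avgZ.
rewrite -mulNr -!nbr_avgZ -nbr_avgD; apply: eq_nbr_avg => y _.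
by rewrite psi_bar1 /psi_bar; field; rewrite gt_eqF.
Qed.

Lemma Gamma_psi_ge0 u x : (forall y, 0 < u y) -> 0 <= Gamma_psi G psi u x.
Proof.
move=> u0; rewrite /Gamma_psi /lap_psi lapE divff ?gt_eqF// psi_bar1.
rewrite -[leLHS](mul0r (deg G x / vmeas G x)) -nbr_avg_cst.
by apply: ler_nbr_avg => y _; rewrite subr0 psi_bar_ge0// divr_gt0.
Qed.

(* The perspective (a, b) |-> a * (psi (b / a) - psi 1) is concave, hence lies
   above its linearisation up to the oscillation [e] of the derivative. *)
Lemma perspective_step M L e h a b al be :
  1 <= a <= M -> 1 <= b <= M -> 1 <= a + h * al <= M -> 1 <= b + h * be <= M ->
  `|al| <= L -> `|be| <= L -> 0 <= h ->
  `|derive1 psi ((b + h * be) / (a + h * al)) - derive1 psi (b / a)| <= e ->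
  a * (psi (b / a) - psi 1) + h * (al * (psi (b / a) - psi 1)
    + derive1 psi (b / a) * (be - al * (b / a))) - h * (L * (1 + M) * e)
  <= (a + h * al) * (psi ((b + h * be) / (a + h * al)) - psi 1).
Proof.
move=> /andP[a1 aM] /andP[b1 bM]; set a' := a + _; set b' := b + _.
move=> /andP[a'1 a'M] /andP[b'1 b'M] alL beL h0 osc.
have a0 : 0 < a by lra.
have a'0 : 0 < a' by lra.
have [c0 c'0] : 0 < b / a /\ 0 < b' / a' by split; apply: divr_gt0; lra.
have cM : b / a <= M by rewrite ler_pdivrMr//; nra.
(* The tangent at the new ratio, evaluated at the old one, bounds the new value from below; the
   price is the slope [q'] in place of [q]. *)
have tan := concave_pos_tangent (b' / a') (b / a) psi_C1 psi_concave c'0 c0.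
set q' := derive1 psi (b' / a') in tan osc; set q := derive1 psi (b / a) in osc *.
set w := be - al * (b / a).
have wL : `|w| <= L * (1 + M).
  rewrite /w (le_trans (ler_normB _ _))// normrM (gtr0_norm c0).
  rewrite mulrDr mulr1 lerD// ler_pM ?normr_ge0// ltW//.
have e0 : 0 <= e := le_trans (normr_ge0 _) osc.
have err : - (L * (1 + M) * e) <= (q' - q) * w.
  have : `|(q' - q) * w| <= L * (1 + M) * e.
    by rewrite normrM mulrC ler_pM.
  by rewrite ler_norml => /andP[].
have e1 : a' * (b / a - b' / a') = - h * w.
  by rewrite /w /b' /a'; field; rewrite !gt_eqF.
have tan' : a' * psi (b / a) <= a' * psi (b' / a') - h * (q' * w).
  have := ler_wpM2l (ltW a'0) tan; rewrite mulrDr mulrCA e1; lra.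
have := ler_wpM2l h0 err.
have -> : a' * (psi (b' / a') - psi 1) = a' * psi (b' / a') - a' * psi 1 by ring.
move: tan'; rewrite /a'; nra.
Qed.

(** Together with uniform continuity of the derivative, this makes the error [e] of
    [perspective_step] small with [h]. *)
Lemma perspective_ratio_close M L h a b al be :
  1 <= a <= M -> 1 <= b <= M -> 1 <= a + h * al <= M ->
  `|al| <= L -> `|be| <= L -> 0 <= h ->
  `|(b + h * be) / (a + h * al) - b / a| <= h * (2 * L * M).
Proof.
move=> /andP[a1 aM] /andP[b1 bM]; set a' := a + _ => /andP[a'1 a'M] alL beL h0.
have a0 : 0 < a by lra.
have a'0 : 0 < a' by lra.
have -> : (b + h * be) / a' - b / a = h * ((be * a - b * al) / (a' * a)).
  by rewrite /a'; field; rewrite !gt_eqF.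
rewrite normrM (ger0_norm h0) ler_wpM2l// normrM [X in _ * X <= _]gtr0_norm ?invr_gt0 ?mulr_gt0//.
have aa : 1 <= a' * a by nra.
rewrite ler_pdivrMr ?mulr_gt0//.
have : `|be * a - b * al| <= 2 * L * M.
  rewrite (le_trans (ler_normB _ _))// !normrM (gtr0_norm a0) (@gtr0_norm _ b); last lra.
  have := normr_ge0 al; have := normr_ge0 be; nra.
have := normr_ge0 (be * a - b * al); nra.
Qed.

(** [perspective_step] is averaged over the neighbours with [a = u x], [b = u y] and increments
    [lap G u x], [lap G u y]. Its first-order terms are u Omega^psi(u) + Delta u Delta^psi u; moving
    the Euler step onto u Delta^psi u subtracts Delta(u Delta^psi u), which leaves exactly 2 u
    Gamma_2^psi(u). *)
Lemma lap_psi_euler M e : 1 <= M -> 0 < e -> exists2 h0, 0 < h0 &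
  forall h u x, 0 < h < h0 -> h * D <= 1 -> (forall y, 1 <= u y <= M) ->
  euler G h (fun y => u y * lap_psi G psi u y) x
    + h * (2 * (u x * Gamma2_psi G psi u x)) - h * e
  <= euler G h u x * lap_psi G psi (euler G h u) x.
Proof.
move=> M1 e0; pose L := 2 * D * M; pose B := L * (1 + M).
have L0 : 0 <= L by rewrite !mulr_ge0//; lra.
have B0 : 0 <= B by rewrite mulr_ge0//; lra.
(* Each neighbour contributes an error [h * (B * e')] and their total mass is at most [D]; the [+ 1]
   avoids division by 0. *)
pose e' := e / (B * D + 1).
have BD : 0 < B * D + 1 by rewrite ltr_wpDl// mulr_ge0.
have e'0 : 0 < e' by rewrite divr_gt0.
have e'e : B * e' * D <= e.
  have : e' * (B * D + 1) = e by rewrite /e' divfK ?gt_eqF.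
  nra.
have M'0 : 0 < M^-1 by rewrite invr_gt0; lra.
have [d d0 Hd] := @derive1_unif_cont R psi M^-1 M psi_C1 M'0 e' e'0.
have LM : 0 < 2 * L * M + 1 by rewrite ltr_wpDl// !mulr_ge0//; lra.
(* The ratios move by at most [h * (2 * L * M)], which must stay below the modulus of continuity
   [d]. *)
exists (d / (2 * L * M + 1)) => [|h u x /andP[h0 hd] hD uM]; first by rewrite divr_gt0.
have u0 y : 0 < u y by have /andP[] := uM y; lra.
have u'M y : 1 <= euler G h u y <= M.
  by have := @iter_euler_bounds _ _ G D degD h (ltW h0) hD 1 u 1 M uM y.
have u'0 y : 0 < euler G h u y by have /andP[] := u'M y; lra.
have vL y : `|lap G u y| <= L.
  by apply: (norm_lap G D degD) => z; rewrite gtr0_norm//; have /andP[] := uM z.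
have ratio s t : 1 <= s <= M -> 1 <= t <= M -> M^-1 <= s / t <= M.
  move=> /andP[s1 sM] /andP[t1 tM]; have t0 : 0 < t by lra.
  rewrite ler_pdivlMr// ler_pdivrMr// mulrC ler_pdivrMr; last lra.
  by apply/andP; split; nra.
have step y : u x * (psi (u y / u x) - psi 1) + h * (lap G u x * (psi (u y / u x) - psi 1)
    + derive1 psi (u y / u x) * (lap G u y - lap G u x * (u y / u x))) - h * (B * e')
    <= euler G h u x * (psi (euler G h u y / euler G h u x) - psi 1).
  apply: perspective_step; rewrite ?uM ?(ltW h0) ?vL//; try exact: u'M.
  apply: Hd; [exact: (ratio _ _ (u'M y) (u'M x))|exact: (ratio _ _ (uM y) (uM x))|].
  apply: (@le_lt_trans _ _ (h * (2 * L * M))).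
    by apply: perspective_ratio_close; rewrite ?uM ?(ltW h0) ?vL//; exact: u'M.
  move: hd; rewrite ltr_pdivlMr//; lra.
rewrite [X in _ <= _ * X]lap_psiE// -nbr_avgZ.
apply: le_trans (ler_nbr_avg G x _ _ (fun y _ => step y)).
rewrite nbr_avgD nbr_avg_cst nbr_avgD !nbr_avgZ -!lap_psiE//.
rewrite [X in _ <= _ + h * X + _]nbr_avgD nbr_avgZ -!lap_psiE//.
rewrite /Gamma2_psi.
have -> : nbr_avg G x (fun y => derive1 psi (u y / u x) *
    (lap G u y - lap G u x * (u y / u x))) = u x * Omega_psi G psi u x.
  rewrite /Omega_psi [X in u x * X]lapE /= subrr mulr0 -nbr_avgZ; apply: eq_nbr_avg => y _.
  by field; rewrite !gt_eqF.
rewrite /euler; set LG := lap G (fun y => u y * _) x.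
have -> : h * (2 * (u x * (2^-1 * (Omega_psi G psi u x + lap G u x * lap_psi G psi u x / u x
    - LG / u x)))) = h * (u x * Omega_psi G psi u x + lap G u x * lap_psi G psi u x - LG).
  by field; rewrite gt_eqF.
have := degD x; have := ltW e'0; have := @deg_ratio_ge0 _ _ G x.
set r := deg G x / vmeas G x => r0 e'0' rD.
have : h * (B * e') * r <= h * e.
  rewrite -mulrA ler_wpM2l ?(ltW h0)//; apply: le_trans e'e.
  by rewrite ler_wpM2l// mulr_ge0.
lra.
Qed.

Lemma lap_psi_bounded M : 1 <= M -> exists2 B, 0 <= B &
  forall u x, (forall y, 1 <= u y <= M) -> `|lap_psi G psi u x| <= B.
Proof.
move=> M1; have M0 : 0 < M^-1 by rewrite invr_gt0; lra.
have M'M : M^-1 <= M by rewrite (@le_trans _ _ 1)// invf_le1//; lra.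
have [B HB] := @C1_pos_bounded R psi M^-1 M psi_C1 M0 M'M.
have B0 : 0 <= B := le_trans (normr_ge0 _) (HB M^-1 ltac:(by rewrite lexx M'M)).
exists (D * B) => [|u x uM]; first exact: mulr_ge0.
have u0 y : 0 < u y by have /andP[] := uM y; lra.
rewrite lap_psiE//; apply: (norm_nbr_avg G D degD) => // y _; apply: HB.
have /andP[y1 yM] := uM y; have /andP[x1 xM] := uM x.
by rewrite ler_pdivlMr// ler_pdivrMr// mulrC ler_pdivrMr; [apply/andP; split; nra|lra].
Qed.

(** The discrete form of Phi' >= (2/n) P_s(u (Delta^psi u)^2) - 2 K Phi. By [Gamma_psiE],
    [lap_psi_euler] becomes an upper bound for the new u Gamma^psi(u), into which the curvature
    condition is inserted. *)
Lemma Gamma_euler_step n K M e : 0 < n -> 0 <= K -> CDpsi G psi n (- K) ->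
  1 <= M -> 0 < e -> exists2 h0, 0 < h0 &
  forall h u x, 0 < h < h0 -> h * D <= 1 -> (forall y, 1 <= u y <= M) ->
  euler G h u x * Gamma_psi G psi (euler G h u) x
    + h * (2 / n * euler G h (fun y => u y * lap_psi G psi u y ^+ 2) x) - h * e
  <= (1 + 2 * K * h) * euler G h (fun y => u y * Gamma_psi G psi u y) x.
Proof.
move=> n0 K0 CD M1 e0.
have [B B0 HB] := lap_psi_bounded M M1.
have [h1 h1_0 Hh1] := lap_psi_euler M (e / 2) M1 ltac:(lra).
pose p := derive1 psi 1.
(* Bounds for the Laplacians of [v] and [g] below: replacing their values at [x] by their Euler
   steps costs [h * B1] and [h * B2], of second order after the factor [h]. *)
pose B1 := 2 * D * (M * B ^+ 2); pose B2 := 2 * D * (`|p| * (2 * D * M) + M * B).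
have B1_0 : 0 <= B1 by rewrite !mulr_ge0// ?sqr_ge0//; lra.
have B2_0 : 0 <= B2.
  by rewrite mulr_ge0// ?addr_ge0// ?mulr_ge0// ?normr_ge0 ?mulr_ge0//; lra.
pose C := 2 / n * B1 + 2 * K * B2.
have C0 : 0 <= C.
  apply: addr_ge0; apply: mulr_ge0 => //; first by rewrite divr_ge0// ltW.
  exact: mulr_ge0.
exists (Num.min h1 (e / (2 * (C + 1)))).
  by rewrite lt_min h1_0 divr_gt0// mulr_gt0//; lra.
move=> h u x /andP[h0]; rewrite lt_min => /andP[hh1 hC] hD uM.
have u0 y : 0 < u y by have /andP[] := uM y; lra.
have u'M y : 1 <= euler G h u y <= M.
  by have := @iter_euler_bounds _ _ G D degD h (ltW h0) hD 1 u 1 M uM y.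
have u'0 y : 0 < euler G h u y by have /andP[] := u'M y; lra.
have step := Hh1 h u x ltac:(by rewrite h0 hh1) hD uM.
have hC2 : h * C <= e / 2.
  move: hC; rewrite ltr_pdivlMr; nra.
set v := fun y => u y * _ ^+ 2; set g := fun y => u y * Gamma_psi _ _ _ _.
have vB y : `|v y| <= M * B ^+ 2.
  have /andP[y1 yM] := uM y; have lB := HB u y uM.
  rewrite normrM normrX gtr0_norm//.
  by apply: ler_pM; rewrite ?(ltW (u0 y)) ?sqr_ge0// lerXn2r// nnegrE.
have gB y : `|g y| <= `|p| * (2 * D * M) + M * B.
  rewrite /g Gamma_psiE// (le_trans (ler_normB _ _))// lerD// normrM.
    rewrite ler_wpM2l//; apply: (norm_lap G D degD) => z.
    by rewrite gtr0_norm//; have /andP[] := uM z.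
  have /andP[y1 yM] := uM y.
  by rewrite gtr0_norm// ler_pM// ?HB// ltW.
have dv : euler G h v x <= v x + h * B1.
  rewrite /euler lerD2l ler_wpM2l ?(ltW h0)// (le_trans (ler_norm _))//.
  exact: (norm_lap G D degD).
have dg : g x - h * B2 <= euler G h g x.
  rewrite /euler lerD2l -mulrN ler_wpM2l ?(ltW h0)//.
  have := norm_lap G D degD g _ x gB; rewrite ler_norml => /andP[]; by [].
have cd := CD u u0 x.
have egE : euler G h g x = p * euler G h (lap G u) x
    - euler G h (fun y => u y * lap_psi G psi u y) x.
  rewrite -mulN1r addrC -[p * _]addr0.
  have -> : g = (fun y => -1 * (u y * lap_psi G psi u y) + p * lap G u y).
    by apply/funext => y; rewrite /g Gamma_psiE// mulN1r addrC.
  rewrite euler_linear addr0; congr (_ + _).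
  exact: (iter_eulerZ G 1 h p (lap G u) x).
have g'E : euler G h u x * Gamma_psi G psi (euler G h u) x =
    p * euler G h (lap G u) x - euler G h u x * lap_psi G psi (euler G h u) x.
  by rewrite Gamma_psiE// lap_euler.
have cdu : 2 / n * v x - 2 * K * g x <= 2 * (u x * Gamma2_psi G psi u x).
  have := ler_wpM2l (ltW (u0 x)) cd; rewrite /v /g.
  by lra.
have cduh := ler_wpM2l (ltW h0) cdu.
have n20 : 0 <= 2 / n by rewrite divr_ge0// ltW.
have dv' := ler_wpM2l n20 dv.
have K20 : 0 <= 2 * K by rewrite mulr_ge0.
have dg' := ler_wpM2l K20 dg.
have S1 := ler_wpM2l (ltW h0) dv'; have S2 := ler_wpM2l (ltW h0) dg'.
have hC3 := ler_wpM2l (ltW h0) hC2.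
rewrite g'E [(1 + _) * _]mulrDl mul1r {1}egE.
move: S1 S2 hC3; rewrite /C; lra.
Qed.

End GammaStep.

(** * The two real recursions: a Gronwall dichotomy and the integration in time *)

Section Recursion.
Context {R : realType}.

(** The family of hypotheses over [g] is Jensen's inequality in linearised form: 2 g Z - g^2 U has
    maximum Z^2 / U, with Z = Y - Phi. The value [g = 0] carries the terminal bound on [Phi]
    backwards; if [Y] is large, [g = Y / (2 * U)] then yields a fixed gain at each step forwards,
    and the total gain cannot exceed the terminal bound. *)
Lemma entropy_recursion (Phi : nat -> R) N (n h c C e E U Y : R) :
  0 < n -> 0 <= h -> 1 <= c -> c ^+ N <= C -> 0 <= e -> N%:R * h * e <= E -> 1 <= U ->
  (forall j, (j < N)%N -> forall g,
    Phi j + h * (2 / n * (2 * g * (Y - Phi j.+1) - g ^+ 2 * U)) - h * e <= c * Phi j.+1) ->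
  (forall j, 0 <= Phi j) -> Phi N <= E * U ->
  Y <= 4 * C * E * U \/ Y ^+ 2 * (N%:R * h) <= 4 * n * C * E * U ^+ 2.
Proof.
move=> n0 h0 c1 cC e0 NhE U1 step Phi0 PhiN.
have c0 : 0 <= c by lra.
have ck k : 1 <= c ^+ k by rewrite exprn_ege1.
have C1 : 1 <= C := le_trans (ck N) cC.
have E0 : 0 <= E by apply: le_trans NhE; rewrite !mulr_ge0.
have he0 : 0 <= h * e by rewrite mulr_ge0.
have back k : (k <= N)%N -> Phi (N - k)%N <= c ^+ k * (Phi N + k%:R * (h * e)).
  elim: k => [|k IH] kN; first by rewrite subn0 expr0; lra.
  (* With [g = 0] the square term disappears. *)
  have := step (N - k.+1)%N ltac:(by rewrite ltn_subrL (leq_trans _ kN)) 0.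
  rewrite -subSn// subSS => st.
  have {}IH := ler_wpM2l c0 (IH (ltnW kN)).
  have : h * e <= c ^+ k.+1 * (h * e) by rewrite ler_peMl.
  rewrite -natr1 exprS; move: IH st; nra.
have PhiC j : (j <= N)%N -> Phi j <= 2 * C * E * U.
  move=> jN; have := back (N - j)%N (leq_subr _ _); rewrite subKn//.
  move/le_trans; apply.
  have cN : c ^+ (N - j) <= C.
    by apply: le_trans cC; rewrite ler_weXn2l// leq_subr.
  have kN : (N - j)%:R * (h * e) <= E.
    apply: le_trans NhE; rewrite -mulrA ler_wpM2r// ler_nat leq_subr//.
  have cN0 : 0 <= c ^+ (N - j) by rewrite exprn_ge0.
  apply: (@le_trans _ _ (C * (E * U + E))).
    apply: ler_pM => //; first by rewrite addr_ge0// mulr_ge0.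
    exact: lerD.
  have EU : E <= E * U by rewrite ler_peMr.
  have := ler_wpM2l (le_trans ler01 C1) EU; lra.
have [|YC] := leP Y (4 * C * E * U); [by left|right].
have U0 : 0 < U by lra.
have Y0 : 0 < Y by apply: le_lt_trans YC; rewrite !mulr_ge0//; lra.
(* The gain per step for [g = Y / (2 * U)] when [Phi] is at most [Y / 2], which holds by [PhiC] and
   [YC]. *)
pose s := h * (Y ^+ 2 / (2 * n * U)).
have forward j : (j <= N)%N -> j%:R * s - C * (j%:R * (h * e)) <= c ^+ j * Phi j.
  elim: j => [|j IH] jN; first by rewrite !mul0r mulr0 subr0 expr0 mul1r.
  have := step j jN (Y / (2 * U)); have := PhiC _ jN => half.
  have gain : s <= h * (2 / n * (2 * (Y / (2 * U)) * (Y - Phi j.+1) - (Y / (2 * U)) ^+ 2 * U)).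
    rewrite /s ler_wpM2l//.
    have -> : 2 / n * (2 * (Y / (2 * U)) * (Y - Phi j.+1) - (Y / (2 * U)) ^+ 2 * U) =
      Y ^+ 2 / (2 * n * U) + 2 * (Y / (n * U)) * (Y / 2 - Phi j.+1).
      by field; rewrite !gt_eqF.
    rewrite lerDl mulr_ge0//; first by rewrite mulr_ge0// divr_ge0 ?mulr_ge0// ltW.
    by lra.
  move=> st.
  have st' : Phi j + s - h * e <= c * Phi j.+1 by lra.
  have cj0 : 0 <= c ^+ j by rewrite exprn_ge0.
  have := ler_wpM2l cj0 st'; have := IH (ltnW jN).
  have s0 : 0 <= s by rewrite mulr_ge0// divr_ge0 ?sqr_ge0// !mulr_ge0// ltW.
  have : s <= c ^+ j * s by rewrite ler_peMl.
  have : c ^+ j * (h * e) <= C * (h * e).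
    by rewrite ler_wpM2r//; apply: le_trans cC; rewrite ler_weXn2l// ltnW.
  rewrite -natr1 exprSr -mulrA; lra.
have := forward N (leqnn N).
have : c ^+ N * Phi N <= C * (E * U) by apply: ler_pM => //; rewrite exprn_ge0.
have : C * (N%:R * (h * e)) <= C * (E * U).
  rewrite ler_wpM2l//; first lra.
  by rewrite mulrA (le_trans NhE)// ler_peMr.
move=> le1 le2 le3.
have : N%:R * s <= 2 * (C * (E * U)) by lra.
have -> : N%:R * s = Y ^+ 2 * (N%:R * h) / (2 * n * U).
  by rewrite /s; field; rewrite !gt_eqF.
rewrite ler_pdivrMr ?mulr_gt0//; lra.
Qed.

(* With [s_j = sqrt (b * j * h)] the second alternative bounds [h * Y j / U j] by
   [b * h / s_j = (s_j ^ 2 - s_(j-1) ^ 2) / s_j <= 2 * (s_j - s_(j-1))], which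
   telescopes. *)
Lemma growth_recursion (U Y : nat -> R) (h p a b : R) N :
  0 < h -> 0 < p -> 0 <= a -> 0 < b -> (forall j, 0 < U j) ->
  (forall j, U j.+1 = U j + h * (Y j / p)) ->
  (forall j, (0 < j <= N)%N -> Y j <= a * U j \/ Y j ^+ 2 * (j%:R * h) <= b * U j ^+ 2) ->
  U N.+1 <= U 1%N * expR ((a * (N%:R * h) + 2 * Num.sqrt (b * (N%:R * h))) / p).
Proof.
move=> h0 p0 a0 b0 U0 UY; elim: N => [|N IH] HY.
  by rewrite !(mul0r, mulr0) sqrtr0 mulr0 addr0 mul0r expR0 mulr1.
have {}IH := IH (fun j jN => HY j ltac:(by case/andP: jN => -> /leqW ->)).
set r := Num.sqrt (b * (N%:R * h)) in IH; set s := Num.sqrt (b * (N.+1%:R * h)).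
have s0 : 0 < s by rewrite sqrtr_gt0 !mulr_gt0.
have r0 : 0 <= r by exact: sqrtr_ge0.
have rs : r <= s by rewrite ler_wsqrtr// ler_pM2l// ler_pM2r// ler_nat.
have s2 : s ^+ 2 = b * (N.+1%:R * h) by rewrite sqr_sqrtr// !mulr_ge0// ltW.
have r2 : r ^+ 2 = b * (N%:R * h) by rewrite sqr_sqrtr// !mulr_ge0// ltW.
have sr2 : s ^+ 2 - r ^+ 2 = b * h by rewrite s2 r2 -natr1; ring.
have UN := U0 N.+1.
have hY : h * Y N.+1 <= (a * h + 2 * (s - r)) * U N.+1.
  case: (HY N.+1 ltac:(by rewrite /= leqnn)) => [YU|YU].
    have := ler_wpM2l (ltW h0) YU.
    have : 0 <= 2 * (s - r) * U N.+1 by rewrite !mulr_ge0 ?subr_ge0// ltW.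
    lra.
  have Ys : Y N.+1 * s <= b * U N.+1.
    have [Y0|Y0] := leP (Y N.+1) 0.
      by apply: (@le_trans _ _ 0); [rewrite mulr_le0_ge0// ltW|rewrite mulr_ge0// ltW].
    rewrite -ler_sqr ?nnegrE; [|by rewrite mulr_ge0// ltW..].
    rewrite !exprMn s2; have := ler_wpM2l (ltW b0) YU; lra.
  have : h * Y N.+1 * s <= 2 * (s - r) * U N.+1 * s.
    apply: (@le_trans _ _ (h * (b * U N.+1))).
      by rewrite -mulrA ler_wpM2l// ltW.
    rewrite mulrCA mulrA (mulrC b) (mulrC h) -sr2.
    have -> : 2 * (s - r) * U N.+1 * s = (s - r) * (2 * s) * U N.+1 by ring.
    rewrite ler_wpM2r ?(ltW UN)// subr_sqr ler_wpM2l ?subr_ge0//; lra.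
  rewrite ler_pM2r// => /le_trans; apply.
  by rewrite ler_wpM2r ?(ltW UN)// lerDr mulr_ge0// ltW.
rewrite UY.
apply: (@le_trans _ _ (U N.+1 * expR ((a * h + 2 * (s - r)) / p))).
  apply: (@le_trans _ _ (U N.+1 * (1 + (a * h + 2 * (s - r)) / p))).
    rewrite mulrDr mulr1 lerD2l mulrA [leRHS]mulrA ler_wpM2r ?invr_ge0 ?(ltW p0)//.
    by rewrite [leRHS]mulrC.
  by rewrite ler_wpM2l ?(ltW UN)// expR_ge1Dx.
have := ler_wpM2r (expR_ge0 ((a * h + 2 * (s - r)) / p)) IH.
rewrite -mulrA -expRD; congr (_ <= _ * expR _).
by rewrite -natr1; ring.
Qed.

End Recursion.

(** * The dichotomy for the Laplacian along the Euler scheme *)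

Section Dichotomy.
Context {R : realType} {V : choiceType} (G : wgraph R V) (D : R) (psi : R -> R).
Context (D_ge0 : 0 <= D) (degD : forall x, deg G x / vmeas G x <= D).
Context (psi_C1 : C1_pos psi) (psi_concave : concave_pos psi).

(** [entropy_recursion] for the discrete Phi(s) at s = j h. The threshold [h0] is uniform in [N] and
    [x], so one step size serves all intermediate times. *)
Lemma lap_euler_dichotomy n K M E T C (f : V -> R) :
  0 < n -> 0 <= K -> CDpsi G psi n (- K) -> 1 <= M -> 0 < E -> 0 < T ->
  expR (2 * K * T) <= C -> (forall y, 1 <= f y <= M) ->
  (forall y, Gamma_psi G psi f y <= E) ->
  exists2 h0, 0 < h0 & forall h N x, 0 < h < h0 -> h * D <= 1 -> N%:R * h <= T ->
  let U := iter N (euler G h) f x in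
  let Y := derive1 psi 1 * lap G (iter N (euler G h) f) x in
  Y <= 4 * C * E * U \/ Y ^+ 2 * (N%:R * h) <= 4 * n * C * E * U ^+ 2.
Proof.
move=> n0 K0 CD M1 E0 T0 KTC fM GfE.
(* With error [E / T] per unit of time, the accumulated error is at most [E], the size of the
   terminal bound. *)
have e0 : 0 < E / T by rewrite divr_gt0.
have [h0 h0_0 Hh0] := Gamma_euler_step G D psi D_ge0 degD psi_C1 psi_concave n K M _ n0 K0 CD M1 e0.
exists h0 => // h N x hh0 hD NhT U Y.
have /andP[h_0 _] := hh0; have hge0 := ltW h_0.
have iM k y : 1 <= iter k (euler G h) f y <= M.
  exact: (iter_euler_bounds G D degD h hge0 hD k f 1 M fM y).
have i0 k y : 0 < iter k (euler G h) f y by have /andP[] := iM k y; lra.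
pose g (u : V -> R) y := u y * Gamma_psi G psi u y.
pose Phi j := iter j (euler G h) (g (iter (N - j) (euler G h) f)) x.
apply: (@entropy_recursion _ Phi N n h (1 + 2 * K * h) C (E / T) E U Y) => //.
- by rewrite lerDl !mulr_ge0.
- apply: le_trans KTC; rewrite (le_trans (lerXn2r N _ _ (expR_ge1Dx (2 * K * h))))//.
  + by rewrite nnegrE addr_ge0// !mulr_ge0.
  + by rewrite nnegrE expR_ge0.
  + by rewrite -expRM_natl ler_expR mulrCA -!mulrA !ler_wpM2l// mulrC.
- exact: ltW.
- by rewrite mulrA ler_pdivrMr// mulrC ler_wpM2l// ltW.
- by have /andP[] := iM N x.
- move=> j jN c; pose u := iter (N - j.+1) (euler G h) f.
  have uS : iter (N - j) (euler G h) f = euler G h u by rewrite /u -iterS -subSn// subSS.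
  have uM y : 1 <= u y <= M by exact: iM.
  have u0 y : 0 < u y by exact: i0.
  (* Lower bound of u (Delta^psi u)^2 from u (Delta^psi u - c)^2 >= 0; it is linear in u Delta^psi u
     and u, whose iterates are known. *)
  pose w y := 2 * c * (u y * lap_psi G psi u y) + - c ^+ 2 * u y.
  have step y : h * (2 / n) * euler G h w y + (g (euler G h u) y + - (h * (E / T)))
      <= (1 + 2 * K * h) * euler G h (g u) y.
    apply: le_trans (Hh0 h u y hh0 hD uM).
    rewrite addrA lerD2r addrC lerD2l -mulrA ler_wpM2l// ler_wpM2l ?divr_ge0 ?(ltW n0)//.
    apply: (ler_iter_euler G D degD h hge0 hD 1) => z; rewrite /w.
    have := ler_wpM2l (ltW (u0 z)) (sqr_ge0 (lap_psi G psi u z - c)); lra.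
  have := ler_iter_euler G D degD h hge0 hD j _ _ step x.
  rewrite (iter_euler_linear G j h (h * (2 / n)) (euler G h w)).
  rewrite (iter_eulerD G j h (g (euler G h u)) (fun=> _)) iter_euler_cst.
  rewrite (iter_eulerZ G j h (1 + 2 * K * h) (euler G h (g u))) -!iterSr.
  rewrite iter_euler_linear /Phi uS -/(g u).
  have uN : iter j.+1 (euler G h) u = iter N (euler G h) f by rewrite -iterD subnKC.
  (* Conservation: [Y] splits into the iterates of u Delta^psi u and of u Gamma^psi(u) at every
     intermediate step. *)
  have -> : iter j.+1 (euler G h) (fun y => u y * lap_psi G psi u y) x =
      Y - iter j.+1 (euler G h) (g u) x.
    rewrite /Y -uN lap_iter_euler -iter_eulerZ -mulN1r addrC -iter_euler_linear.
    congr (iter _ _ _ x); apply/funext => y.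
    by rewrite /g Gamma_psiE//; ring.
  rewrite iter_eulerZ uN -/U -/u; lra.
- move=> j; apply: (iter_euler_ge0 G D degD h hge0 hD) => y.
  by rewrite mulr_ge0 ?(ltW (i0 _ _))// Gamma_psi_ge0.
- rewrite /Phi subnn /= /U.
  have -> : E * iter N (euler G h) f x = iter N (euler G h) (fun y => E * f y) x.
    by rewrite iter_eulerZ.
  apply: (ler_iter_euler G D degD h hge0 hD) => y.
  by rewrite /g mulrC ler_wpM2r// (ltW (i0 0%N y)).
Qed.

End Dichotomy.

(** * Graph distance and its truncated exponential *)

Section Distance.
Context {R : realType} {V : choiceType} (G : wgraph R V).
Implicit Types x y z : V.

Lemma gdist_walk x y : exists p, [/\ path (adj G) x p, last x p = y & size p = gdist G x y].
Proof. by rewrite /gdist; case: ex_minnP => k /asboolP. Qed.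

Lemma gdist_le_size x y p : path (adj G) x p -> last x p = y -> (gdist G x y <= size p)%N.
Proof.
move=> xp py; rewrite /gdist; case: ex_minnP => k _; apply.
by apply/asboolP; exists p.
Qed.

Lemma gdistxx x : gdist G x x = 0%N.
Proof. by have := @gdist_le_size x x [::] isT erefl; rewrite leqn0 => /eqP. Qed.

Lemma gdist_adj x y z : adj G y z -> (gdist G x z <= (gdist G x y).+1)%N.
Proof.
move=> yz; have [p [xp py <-]] := gdist_walk x y.
rewrite -(size_rcons p z); apply: gdist_le_size; last exact: last_rcons.
by rewrite rcons_path xp py.
Qed.

(** The truncation at [m] keeps the function bounded, as the Euler estimates require; with [m] at
    least [r] it is invisible to Markov's inequality on the ball of radius [r]. *)
Definition exp_dist (l : R) (m : nat) x : V -> R :=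
  fun y => expR (l * (minn (gdist G x y) m)%:R).

Lemma exp_dist_bounds l m x y : 0 <= l -> 1 <= exp_dist l m x y <= expR (l * m%:R).
Proof.
move=> l0; apply/andP; split; first by rewrite -[leLHS]expR0 ler_expR mulr_ge0.
by rewrite ler_expR ler_wpM2l// ler_nat geq_minr.
Qed.

(** Truncated distances of neighbours differ by 0, 1 or -1, so the ratios are 1, exp(l) or exp(-l):
    there [psi_bar] is 0 or at most [eta_psi psi l]. *)
Lemma Gamma_exp_dist psi D C l m x y : C1_pos psi -> concave_pos psi ->
  deg G y / vmeas G y <= D -> 0 <= C -> eta_psi psi l <= C ->
  Gamma_psi G psi (exp_dist l m x) y <= D * C.
Proof.
move=> C1 cvx degD C0 etaC; rewrite /Gamma_psi /lap_psi lapE divff ?gt_eqF ?expR_gt0//.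
rewrite psi_bar1; apply: (@le_trans _ _ (nbr_avg G y (fun=> C))); last first.
  by rewrite nbr_avg_cst mulrC ler_wpM2r.
apply: ler_nbr_avg => z yz; rewrite subr0 /exp_dist -expRB -mulrBr.
have yz' := @gdist_adj x y z yz.
have zy' : (gdist G x y <= (gdist G x z).+1)%N by apply: gdist_adj; rewrite adj_sym.
set i := minn _ m; set j := minn _ m.
have [->|[->|->]] : i%:R - j%:R = 0 :> R \/ i%:R - j%:R = 1 :> R \/ i%:R - j%:R = -1 :> R.
  have [ij|ij|ij] := ltngtP i j; last by left; rewrite ij subrr.
    right; right; have -> : j = i.+1 by lia.
    by rewrite -natr1; ring.
  right; left; have -> : i = j.+1 by lia.
  by rewrite -natr1; ring.
- by rewrite mulr0 expR0 psi_bar1.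
- by rewrite mulr1; apply: le_trans etaC; rewrite /eta_psi le_max lexx.
- by rewrite mulrN1; apply: le_trans etaC; rewrite /eta_psi le_max lexx orbT.
Qed.

(* Markov's inequality for [exp_dist]. *)
Lemma indic_gball_ge b r m x y : 0 < b -> 0 < r -> r <= m%:R ->
  1 - expR (- b) * exp_dist (b / r) m x y <= \1_(gball G x r) y.
Proof.
move=> b0 r0 rm; rewrite indicE; case: (boolP (y \in _)) => [_|] /=.
  by rewrite gerBl mulr_ge0 ?expR_ge0.
move/negP; rewrite inE /gball /= => /negP; rewrite -leNgt => rd.
rewrite subr_le0 /exp_dist -expRD -[leLHS]expR0 ler_expR addrC subr_ge0.
rewrite mulrAC ler_pdivlMr// ler_pM2l//.
by rewrite /minn; case: ifP.
Qed.

End Distance.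

(** * The time scale, the choice of constants and the conclusion *)

Lemma time_scale_bounds {R : realType} (A r K : R) : 0 < A -> 0 < r -> 0 <= K ->
  [/\ 0 < time_scale A r K, time_scale A r K <= A * r ^+ 2 & K * time_scale A r K <= A].
Proof.
move=> A0 r0 K0; rewrite /time_scale; have r2 : 0 < r ^+ 2 by rewrite exprn_gt0.
case: eqP => [->|/eqP Kn0].
  by rewrite mul0r mulr_gt0// lexx ltW.
have {Kn0}K1 : 0 < K by rewrite lt_def Kn0.
have Ki : 0 < K^-1 by rewrite invr_gt0.
split; first by rewrite mulr_gt0// lt_min r2.
  by rewrite ler_pM2l// ge_min lexx.
have : Num.min (r ^+ 2) K^-1 <= K^-1 by rewrite ge_min lexx orbT.
move=> /(ler_wpM2l K0); rewrite divff ?gt_eqF// => H.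
by rewrite mulrCA ger_pMr.
Qed.

Theorem theorem5p3 (R : realType) (n : R) (psi : R -> R) (D : R)
  (n_gt0 : 0 < n)
  (psi_C1 : C1_pos psi) (psi_concave : concave_pos psi)
  (dpsi1_gt0 : 0 < derive1 psi 1)
  (H_fin : (H_psi psi < +oo)%E) (eta_fin : (limsup_eta psi < +oo)%E) :
  exists rho A : R, [/\ 0 < rho, 0 < A &
    forall (V : choiceType) (G : wgraph R V) (K : R),
      Dmu G = D%:E -> (mu_max G < +oo)%E -> (0 < w_min G)%E ->
      0 <= K -> CDpsi G psi n (- K) ->
      forall (x : V) (r : R), 2^-1 <= r ->
        rho <= heat G (time_scale A r K) (\1_(gball G x r)) x].
Proof.
have [c [l0 [c0 l0_0 eta_c]]] := eta_psi_quadratic psi eta_fin.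
set p := derive1 psi 1 in dpsi1_gt0.
(* Since [r] is at least 1/2, [l = b / r] is at most [l0 / 2], inside the range of [eta_c]. *)
pose b := l0 / 4; have b0 : 0 < b by rewrite divr_gt0.
(* No graph is given yet, so [D] has no known sign; this factor is positive and dominates [D]. *)
pose e1 := (`|D| + 1) * c; have e1_0 : 0 < e1 by rewrite mulr_gt0.
pose C := expR 2 : R; have C0 : 0 < C by exact: expR_gt0.
pose k := Num.sqrt (n * C * e1); have k0 : 0 <= k by exact: sqrtr_ge0.
(* The final growth exponent will be at most [b * s * q / p], and [s] is chosen to make this at most
   [b / 4]. The choice [s <= 1] also gives K T <= 1, whence the value of [C]. *)
pose q := 4 * C * e1 * b + 4 * k.
have q0 : 0 <= q by rewrite addr_ge0 ?mulr_ge0// ltW.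
pose s := Num.min 1 (p / (4 * (q + 1))).
have s0 : 0 < s by rewrite lt_min ltr01 divr_gt0// mulr_gt0// ltr_wpDl.
have s1 : s <= 1 by rewrite ge_min lexx.
have sq : s * q <= p / 4.
  have : s <= p / (4 * (q + 1)) by rewrite ge_min lexx orbT.
  rewrite ler_pdivlMr ?mulr_gt0 ?ltr_wpDl//; nra.
(* Markov's inequality contributes exp(-b), the growth of [U] at most exp(b / 2). *)
exists (1 - expR (- (b / 2))), (s ^+ 2); split.
- by rewrite subr_gt0 -[ltRHS]expR0 ltr_expR oppr_lt0 divr_gt0.
- exact: exprn_gt0.
move=> V G K DmuE _ _ K0 CD x r r_half.
have r0 : 0 < r by lra.
have [T0 TA KTA] := time_scale_bounds (s ^+ 2) r K (exprn_gt0 2 s0) r0 K0.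
set T := time_scale _ _ _ in T0 TA KTA *.
have degD y : deg G y / vmeas G y <= D.
  by rewrite -lee_fin -DmuE; apply: ereal_sup_ubound; exists y.
have D0 : 0 <= D := le_trans (deg_ratio_ge0 G x) (degD x).
pose l := b / r; have l_0 : 0 < l by rewrite divr_gt0.
have ll0 : l < l0 by rewrite /l /b ltr_pdivrMr//; nra.
pose E := e1 * l ^+ 2; have E0 : 0 < E by rewrite mulr_gt0// exprn_gt0.
pose m := Num.bound r; have rm : r <= m%:R by rewrite ltW// archi_boundP// ltW.
pose f := exp_dist G l m x; pose M := expR (l * m%:R).
have fM y : 1 <= f y <= M by apply: exp_dist_bounds; exact: ltW.
have M1 : 1 <= M by have /andP[/le_trans] := fM x; apply.
have GfE y : Gamma_psi G psi f y <= E.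
  apply: (@le_trans _ _ (D * (c * l ^+ 2))).
    apply: Gamma_exp_dist => //; first by rewrite mulr_ge0 ?sqr_ge0// ltW.
    by apply: eta_c; rewrite l_0.
  rewrite mulrA /E /e1 ler_wpM2r ?sqr_ge0// ler_wpM2r ?(ltW c0)//.
  by have := ler_norm D; lra.
have KTC : expR (2 * K * T) <= C.
  have s21 : s ^+ 2 <= 1 by apply: exprn_ile1 => //; exact: ltW.
  by rewrite ler_expR; lra.
have [h0 h0_0 dich] := lap_euler_dichotomy G D psi D0 degD psi_C1 psi_concave n K M E T C f
  n_gt0 K0 CD M1 E0 T0 KTC fM GfE.
pose Bf := 2 * D * M.
have Bf0 : 0 <= Bf by rewrite !mulr_ge0//; lra.
(* The three bounds on [h] serve the dichotomy, positivity of the Euler operator, and the first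
   Euler step. *)
pose hb := Num.min h0 (Num.min (D + 1)^-1 (b / (4 * (Bf + 1)))).
have hb0 : 0 < hb.
  by rewrite !lt_min h0_0 invr_gt0 divr_gt0// ?mulr_gt0// ltr_wpDl.
have indic1 y : `|\1_(gball G x r) y : R| <= 1.
  by rewrite indicE; case: (_ \in _); rewrite ?normr1 ?normr0.
have heat_cvg := heat_euler_cvg G D degD T _ 1 x (ltW T0) indic1.
(* It suffices to bound the Euler iterates from below for all large [N]. *)
rewrite -(cvg_lim _ heat_cvg)//; apply: limr_ge; first by apply/cvg_ex; eexists; exact: heat_cvg.
have Thb : 0 < hb / T by rewrite divr_gt0.
near=> N.
set h := T / N.+1%:R.
have h_0 : 0 < h by rewrite divr_gt0.
have hhb : h < hb.
  have : N.+1%:R^-1 < hb / T by near: N; exact: (near_infty_natSinv_lt (PosNum Thb)).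
  by rewrite ltr_pdivlMr// mulrC.
have [hh0 hD1 hBf] : [/\ h < h0, h < (D + 1)^-1 & h < b / (4 * (Bf + 1))].
  by move: hhb; rewrite !lt_min => /andP[? /andP[]].
have hD : h * D <= 1.
  move: hD1; rewrite -[(D + 1)^-1]div1r ltr_pdivlMr; last lra.
  lra.
have NhT : N.+1%:R * h = T by rewrite /h mulrC divfK// pnatr_eq0.
pose U j := iter j (euler G h) f x.
pose Y j := p * lap G (iter j (euler G h) f) x.
have U0 j : 0 < U j.
  have /andP[] := iter_euler_bounds G D degD h (ltW h_0) hD j f 1 M fM x; rewrite -/(U j); lra.
have UY j : U j.+1 = U j + h * (Y j / p).
  by rewrite /U /Y /= {1}/euler; congr (_ + h * _); field; rewrite gt_eqF.
have grow : U N.+1 <= U 1%N *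
    expR ((4 * C * E * (N%:R * h) + 2 * Num.sqrt (4 * n * C * E * (N%:R * h))) / p).
  apply: (@growth_recursion _ U Y) => //.
  - by rewrite mulr_ge0 ?(ltW E0)// mulr_ge0// ltW.
  - by rewrite mulr_gt0// mulr_gt0// mulr_gt0.
  - move=> j /andP[j0 jN]; apply: dich => //; first by rewrite h_0.
    by rewrite -NhT ler_wpM2r ?(ltW h_0)// ler_nat (leq_trans jN).
have NhTle : N%:R * h <= T by rewrite -NhT ler_wpM2r ?(ltW h_0)// ler_nat.
(* Here [r] cancels: [E] carries [(b / r) ^+ 2] and the time is at most [s ^+ 2 * r ^+ 2]. *)
have ET : E * (N%:R * h) <= e1 * b ^+ 2 * s ^+ 2.
  apply: (@le_trans _ _ (E * (s ^+ 2 * r ^+ 2))).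
    by rewrite ler_wpM2l ?(ltW E0)// (le_trans NhTle).
  have -> : E * (s ^+ 2 * r ^+ 2) = e1 * b ^+ 2 * s ^+ 2 by rewrite /E /l; field; rewrite gt_eqF.
  exact: lexx.
have sqrtT : Num.sqrt (4 * n * C * E * (N%:R * h)) <= 2 * k * b * s.
  have bs0 : 0 <= 2 * k * b * s by rewrite mulr_ge0 ?(ltW s0)// mulr_ge0 ?(ltW b0)// mulr_ge0.
  rewrite -[leRHS]ger0_norm// -sqrtr_sqr ler_wsqrtr//.
  have -> : (2 * k * b * s) ^+ 2 = 4 * k ^+ 2 * b ^+ 2 * s ^+ 2 by ring.
  rewrite sqr_sqrtr; last by rewrite mulr_ge0 ?(ltW e1_0)// mulr_ge0 ?(ltW C0)// ltW.
  have nC : 0 <= 4 * n * C by rewrite mulr_ge0 ?(ltW C0)// mulr_ge0// ltW.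
  have := ler_wpM2l nC ET; lra.
have expo : (4 * C * E * (N%:R * h) + 2 * Num.sqrt (4 * n * C * E * (N%:R * h))) / p <= b / 4.
  rewrite ler_pdivrMr//.
  have C4 : 0 <= 4 * C by rewrite mulr_ge0// ltW.
  have := ler_wpM2l C4 ET.
  have s2s : s ^+ 2 <= s by rewrite expr2 ger_pMr.
  have : 4 * C * (e1 * b ^+ 2 * s ^+ 2) <= 4 * C * (e1 * b ^+ 2 * s).
    by rewrite ler_wpM2l// ler_wpM2l// mulr_ge0 ?sqr_ge0// ltW.
  have := ler_wpM2l (ltW b0) sq; rewrite /q; lra.
(* The first step is treated by hand, because at time 0 the second alternative of the dichotomy
   gives no bound on [Y]. *)
have U1 : U 1%N <= expR (b / 4).
  apply: le_trans (expR_ge1Dx _); rewrite /U /= /euler.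
  have -> : f x = 1 by rewrite /f /exp_dist gdistxx min0n mulr0 expR0.
  rewrite lerD2l.
  have lapB : lap G f x <= Bf.
    apply: (le_trans (ler_norm _)); apply: (norm_lap G D degD) => y.
    by have /andP[y1 yM] := fM y; rewrite ger0_norm//; lra.
  have := ler_wpM2l (ltW h_0) lapB.
  move: hBf; rewrite ltr_pdivlMr ?mulr_gt0 ?ltr_wpDl//; lra.
have UN : U N.+1 <= expR (b / 2).
  apply: (le_trans grow); rewrite [leRHS](_ : _ = expR (b / 4) * expR (b / 4)); last first.
    by rewrite -expRD; congr expR; lra.
  by apply: ler_pM; rewrite ?expR_ge0 ?(ltW (U0 _))// ler_expR.
have markov y : 1 - expR (- b) * f y <= \1_(gball G x r) y by exact: indic_gball_ge.
apply: le_trans (ler_iter_euler G D degD h (ltW h_0) hD N.+1 _ _ markov x).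
have -> : iter N.+1 (euler G h) (fun y => 1 - expR (- b) * f y) x = 1 - expR (- b) * U N.+1.
  have := iter_euler_linear G N.+1 h (- expR (- b)) f (fun=> 1) x.
  rewrite iter_euler_cst mulNr [in RHS]addrC => <-.
  by congr (iter _ _ _ x); apply/funext => y; rewrite mulNr addrC.
rewrite lerD2l lerN2.
apply: (le_trans (ler_wpM2l (expR_ge0 _) UN)); rewrite -expRD ler_expR; lra.
Unshelve. all: by end_near. Qed.
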